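(* Let $A\in \mathbb{R}^{n\times n}$, $p\in [n]$, and let $\overline{Z}_p=\mathtt{Zone}(\overline{D}_p)$, where $\overline{D}_p$ is the limit of the sequence of matrices $\{D_p^k\}_{k\ge 0}$ associated with $A$ and $p$. Then $E_p(A)\subseteq \overline{Z}_p$.
   Context: Notation: $[n]=\{1,\dots,n\}$. For $\omega=p/n$, $p\in[n]$, $A\in\mathbb{R}^{n\times n}$ and $x\in\mathbb{R}^n$, the vector $A\otimes_\omega x$ has $i$-th entry equal to the $p$-th smallest element (counted with multiplicity) of the multiset $\{A(i,1)+x_1,\dots,A(i,n)+x_n\}$. For a scalar $\lambda$ and vector $x$, $\lambda+x$ is the vector with entries $\lambda+x_i$. A maxmin-$\omega$ eigenvalue of $A$ is a $\lambda_p\in\mathbb{R}$ such that $A\otimes_\omega x=\lambda_p+x$ for some $x\in\mathbb{R}^n$; it exists and is unique for each $A$ and $p$. The eigenspace $E_p(A)$ is the set of all $x\in\mathbb{R}^n$ with $A\otimes_\omega x=\lambda_p+x$. For $D\in(\mathbb{R}\cup\{-\infty\})^{n\times n}$ with zero diagonal, $\mathtt{Zone}(D)=\{x\in\mathbb{R}^n : x_i-x_j\ge D(i,j)\ \forall i,j\in[n]\}$. For $D\in(\mathbb{R}\cup\{-\infty\})^{n\times n}$ and real row vectors $a,b$ of length $n$, put $$\mathtt{MinMaxValue}(D,a,b\mid p,n+1-p)=\min_{S_1,S_2}\ \max_{i\in S_1,\,j\in S_2}\bigl(D(i,j)+a_i-b_j\bigr),$$ where $S_1$ ranges over all $p$-element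 subsets and $S_2$ over all $(n+1-p)$-element subsets of $[n]$. The sequence $\{D_p^k\}_{k\ge0}$ is defined by $D_p^0=I_n$ (the max-plus identity: zero diagonal, $-\infty$ off the diagonal) and $D_p^{k+1}(i,j)=\mathtt{MinMaxValue}(D_p^k,A_i,A_j\mid p,n+1-p)$ for all $i,j\in[n]$, where $A_i$ denotes the $i$-th row of $A$. The entrywise limit $\overline{D}_p=\lim_{k\to\infty}D_p^k$ exists (the sequence is entrywise nondecreasing and bounded above, with finite entries for $k\ge1$). *)

(* Defs.v *)
From mathcomp Require Import all_boot all_order all_algebra.
From mathcomp Require Import all_classical all_reals all_analysis.

Set Implicit Arguments.
Unset Strict Implicit.
Unset Printing Implicit Defensive.
Import Order.TTheory GRing.Theory Num.Theory.
Local Open Scope classical_set_scope.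
Local Open Scope ring_scope.

(* The product of A and x at omega = p / n, indexed by p (counted from 1):
   each entry is the p-th smallest term, with multiplicity. *)
Definition maxmin_mul (R : realType) (n p : nat) (A : 'M[R]_n) (x : 'cV[R]_n) :
    'cV[R]_n :=
  \col_i nth 0 (sort <=%R [seq A i j + x j 0 | j <- enum 'I_n]) p.-1.

Definition maxmin_eigenvalue (R : realType) (n p : nat) (A : 'M[R]_n) (l : R) :
    Prop :=
  exists x : 'cV[R]_n, maxmin_mul p A x = const_mx l + x.

(* For 1 <= p <= n the eigenvalue exists and is unique, so the quantifier over l
   only names it. *)
Definition maxmin_eigenspace (R : realType) (n p : nat) (A : 'M[R]_n) :
    set 'cV[R]_n :=
  [set x | exists2 l : R, maxmin_eigenvalue p A l
                        & maxmin_mul p A x = const_mx l + x].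

(* Matrices over R with -oo adjoined are taken over \bar R; the value +oo does
   not arise in the sequence below when 1 <= p <= n. *)
Definition Zone (R : realType) (n : nat) (D : 'M[\bar R]_n) : set 'cV[R]_n :=
  [set x | forall i j, (D i j <= (x i 0 - x j 0)%:E)%E].

Definition MinMaxValue (R : realType) (n : nat) (D : 'M[\bar R]_n)
    (a b : 'rV[R]_n) (p q : nat) : \bar R :=
  (\big[mine/+oo]_(S1 : {set 'I_n} | #|S1| == p)
   \big[mine/+oo]_(S2 : {set 'I_n} | #|S2| == q)
     \big[maxe/-oo]_(i in S1) \big[maxe/-oo]_(j in S2)
       (D i j + (a 0 i - b 0 j)%:E))%E.

Definition maxplus_id (R : realType) (n : nat) : 'M[\bar R]_n :=
  \matrix_(i, j) (if i == j then 0 else -oo)%E.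

Fixpoint Dseq (R : realType) (n p : nat) (A : 'M[R]_n) (k : nat) :
    'M[\bar R]_n :=
  if k is k'.+1 then
    \matrix_(i, j)
      MinMaxValue (Dseq p A k') (row i A) (row j A) p (n.+1 - p)%N
  else maxplus_id R n.

Definition Dlim (R : realType) (n p : nat) (A : 'M[R]_n) : 'M[\bar R]_n :=
  \matrix_(i, j) (limn (fun k => Dseq p A k i j) : \bar R).

(* Main.v *)
(** An eigenvector [x] with eigenvalue [l] makes at least [p] of the terms
    [A i s + x s] at most [l + x i], and at least [n + 1 - p] of the terms
    [A j t + x t] at least [l + x j]. On index sets of these sizes a bound
    [D s t <= x s - x t] gives [D s t + A i s - A j t <= x i - x j], so the zones
    of all the [D^k] contain [x]. The bound passes to the limit because the
    sequence is monotone: two index sets of sizes [p] and [n + 1 - p] meet, hence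
    [D^0 <= D^1], and [MinMaxValue] is monotone in its matrix. *)
Require Import Defs.
From mathcomp Require Import all_boot all_order all_algebra.
From mathcomp Require Import all_classical all_reals all_analysis.
From mathcomp Require Import lra.

Import Order.TTheory GRing.Theory Num.Theory.

Local Open Scope classical_set_scope.
Local Open Scope ring_scope.

(** Trims the level sets of [maxmin_mul_rank] to the exact sizes over which [MinMaxValue]
    minimises. *)
Lemma exists_subset_card (T : finType) (A : {set T}) (k : nat) :
  (k <= #|A|)%N -> exists2 B : {set T}, B \subset A & #|B| == k.
Proof.
move=> /card_geqP[s [us <- sA]]; exists [set x in s]%SET.
  by apply/fintype.subsetP => x; rewrite inE; exact: sA.
by rewrite cardsE; apply/eqP/card_uniqP.
Qed.

Lemma count_map_enum (T : finType) (U : Type) (f : T -> U) (P : pred U) :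
  count P [seq f j | j <- enum T] = #|[set j | P (f j)]%SET|.
Proof. by rewrite count_map cardsE -size_filter cardE enumT; congr size. Qed.

Section Sorted.
Context {d : Order.disp_t} {T : orderType d} (x0 : T) (s : seq T) (k : nat).
Hypotheses (s_sorted : sorted <=%O s) (ks : (k < size s)%N).

(** The prefix of length [k.+1] already supplies enough entries; ties can only add more. The next
    lemma uses the suffix from index [k] likewise. *)
Lemma count_le_nth_sorted : (k < count (<= nth x0 s k)%O s)%N.
Proof.
rewrite -[X in count _ X](cat_take_drop k.+1) count_cat.
apply: leq_trans (leq_addr _ _).
suff: all (<= nth x0 s k)%O (take k.+1 s).
  by rewrite all_count => /eqP ->; rewrite size_takel.
apply/(all_nthP x0) => i; rewrite size_takel// => ik.
rewrite nth_take//; apply: (sorted_leq_nth le_trans le_refl) => //.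
by rewrite inE (leq_trans ik).
Qed.

Lemma count_ge_nth_sorted : (size s - k <= count (>= nth x0 s k)%O s)%N.
Proof.
rewrite -[X in count _ X](cat_take_drop k) count_cat.
apply: leq_trans (leq_addl _ _).
suff: all (>= nth x0 s k)%O (drop k s).
  by rewrite all_count => /eqP ->; rewrite size_drop.
apply/(all_nthP x0) => i; rewrite size_drop => ik.
have kis : (k + i < size s)%N by rewrite -ltn_subRL.
rewrite nth_drop /=; apply: (sorted_leq_nth le_trans le_refl) => //.
exact: leq_addr.
Qed.

End Sorted.

Section Eigenspace.
Variables (R : realType) (n p : nat) (A : 'M[R]_n).
Hypothesis pn : (1 <= p <= n)%N.

Lemma maxmin_mul_rank (x : 'cV[R]_n) (i : 'I_n) :
  (p <= #|[set j | (A i j + x j 0 <= maxmin_mul p A x i 0)%R]%SET|)%N /\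
  (n.+1 - p <= #|[set j | (maxmin_mul p A x i 0 <= A i j + x j 0)%R]%SET|)%N.
Proof.
case/andP: pn => p_gt0 p_le_n.
rewrite mxE; set s := [seq _ | j <- _].
have ss : sorted <=%R (sort <=%R s) by apply: sort_sorted; exact: le_total.
have szs : size (sort <=%R s) = n by rewrite size_sort size_map size_enum_ord.
(* The [p]-th smallest term has index [p.-1] and counts on both sides, so the two bounds [p] and
   [n - p.-1 = n.+1 - p] add up to [n.+1]. *)
have ps : (p.-1 < size (sort <=%R s))%N by rewrite szs prednK.
have := count_le_nth_sorted 0 _ _ ss ps.
have := count_ge_nth_sorted 0 _ _ ss ps.
rewrite szs !count_sort !count_map_enum prednK//.
by rewrite -subSS prednK.
Qed.

Lemma zone_step (D : 'M[\bar R]_n) (l : R) (x : 'cV[R]_n) (i j : 'I_n) :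
    maxmin_mul p A x = const_mx l + x -> Zone D x ->
  (MinMaxValue D (row i A) (row j A) p (n.+1 - p) <= (x i 0 - x j 0)%:E)%E.
Proof.
move=> Ax Dx.
have [+ _] := maxmin_mul_rank x i; move=> /exists_subset_card[S1 S1i cS1].
have [_] := maxmin_mul_rank x j; move=> /exists_subset_card[S2 S2j cS2].
apply: bigmin_inf cS1 _; apply: bigmin_inf cS2 _.
apply/bigmax_leP; split=> [|s /(fintype.subsetP S1i)]; first exact: leNye.
rewrite inE Ax !mxE => ineqi.
apply/bigmax_leP; split=> [|t /(fintype.subsetP S2j)]; first exact: leNye.
rewrite inE Ax !mxE => ineqj.
(* After the zone bound at [(s, t)], [l] cancels between [ineqi] and [ineqj]. *)
apply: (le_trans (leeD2r _ (Dx s t))).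
rewrite -EFinD lee_fin; lra.
Qed.

Lemma Dseq_zone (l : R) (x : 'cV[R]_n) (k : nat) :
  maxmin_mul p A x = const_mx l + x -> Zone (Dseq p A k) x.
Proof.
move=> Ax; elim: k => [|k IHk] i j; rewrite mxE.
  by case: eqP => [->|_]; rewrite ?subrr ?lexx ?leNye.
exact: zone_step _ _ _ _ _ Ax IHk.
Qed.

Lemma MinMaxValue_le (D E : 'M[\bar R]_n) (a b : 'rV[R]_n) (q r : nat) :
    (forall i j, D i j <= E i j)%E ->
  (MinMaxValue D a b q r <= MinMaxValue E a b q r)%E.
Proof.
move=> DE; apply: le_bigmin2 => S1 _; apply: le_bigmin2 => S2 _.
by apply: le_bigmax2 => s _; apply: le_bigmax2 => t _; exact: leeD2r.
Qed.

(** Only the diagonal of [Dseq p A 0] is finite, so the base case of monotonicity reduces to this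
    bound. *)
Lemma Dseq1_diag_ge0 (i : 'I_n) : (0 <= Dseq p A 1 i i)%E.
Proof.
case/andP: pn => p_gt0 p_le_n; rewrite mxE.
apply/bigmin_geP; split=> [|S1 /eqP cS1]; first exact: leey.
apply/bigmin_geP; split=> [|S2 /eqP cS2]; first exact: leey.
(* Pigeonhole: the sizes sum to [n.+1], while the union has at most [n] elements. *)
have /set0Pn[s] : S1 :&: S2 != finset.set0.
  rewrite -card_gt0 -(ltn_add2l #|S1 :|: S2|) cardsUI cS1 cS2 addn0.
  by rewrite (subnKC (leqW p_le_n)) ltnS -[X in (_ <= X)%N]card_ord max_card.
rewrite inE => /andP[sS1 sS2].
apply: bigmax_sup sS1 _; apply: bigmax_sup sS2 _.
(* At [(s, s)] the identity contributes 0 and the two equal row entries cancel. *)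
by rewrite !mxE eqxx subrr adde0.
Qed.

Lemma Dseq_nondecreasing (i j : 'I_n) :
  nondecreasing_seq (fun k => Dseq p A k i j).
Proof.
apply/nondecreasing_seqP => k; elim: k i j => [|k IHk] i j.
  by rewrite [Dseq p A 0]/= mxE; case: eqP => [->|_];
    [exact: Dseq1_diag_ge0|exact: leNye].
by rewrite /= mxE [leRHS]mxE; apply: MinMaxValue_le.
Qed.

End Eigenspace.

Theorem proposition3p9 (R : realType) (n p : nat) (A : 'M[R]_n) :
  (1 <= p <= n)%N -> maxmin_eigenspace p A `<=` Zone (Dlim p A).
Proof.
move=> pn x [l _ Ax] i j; rewrite mxE.
(* A bound on every term bounds the limit once convergence is known, which monotonicity gives in
   [\bar R]. *)
apply: lime_le.
  exact/ereal_nondecreasing_is_cvgn/Dseq_nondecreasing.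
by apply: nearW => k; exact: Dseq_zone pn _ _ _ Ax i j.
Qed.
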